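(* Let $p\in\mathbb{R}$, let $f(z)=z^{p}$, and for $c>0$ let $P_{c}$ denote the Taylor polynomial to $f$ of order $3$ at $x=c$. (i) If $p\geq\frac{7}{2}$, then for any $0<a<b$, $P_{b}-P_{a}$ has nonreal roots $x_{1}\pm iy_{1}$ (with $x_1,y_1\in\mathbb{R}$, $y_1\ne0$) with $a<x_{1}$. (ii) If $p<2$ and $p\neq 0,1$, then for any $0<a<b$, $P_{b}-P_{a}$ has nonreal roots $x_{1}\pm iy_{1}$ (with $x_1,y_1\in\mathbb{R}$, $y_1\neq0$) with $x_{1}<b$.
   Context: The Taylor polynomial to $f$ of order $3$ at $c>0$ is $P_c(z)=\sum_{k=0}^{3}\frac{f^{(k)}(c)}{k!}(z-c)^k$, where the derivatives are those of the real function $x\mapsto x^p$ on $(0,\infty)$; $P_c$ is regarded as a polynomial in the complex variable $z$. *)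

(* Defs.v *)
From Stdlib Require Import Reals Factorial.
From Coquelicot Require Import Coquelicot.
Open Scope R_scope.

(* The coefficients are real; the variable z is complex. *)
Definition taylor_poly (f : R -> R) (n : nat) (c : R) (z : C) : C :=
  sum_n (fun k => RtoC (Derive_n f k c / INR (fact k)) * (z - RtoC c) ^ k)%C n.

(* [Rpower x p] is exp (p * ln x), i.e. the real power x^p on (0, +oo); its
   values for x <= 0 are junk, and do not affect derivatives at c > 0. *)
Definition P (p c : R) (z : C) : C :=
  taylor_poly (fun x => Rpower x p) 3 c z.

Definition nonreal_root_pair (Q : C -> C) (x y : R) : Prop :=
  y <> 0 /\
  Q (RtoC x + Ci * RtoC y)%C = RtoC 0 /\
  Q (RtoC x - Ci * RtoC y)%C = RtoC 0.

(* Main.v *)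
Require Import Defs.
From Stdlib Require Import Reals Lra.
From Coquelicot Require Import Coquelicot.
Open Scope R_scope.

(** Differentiating in [c] gives [d/dc P_c(z) = K c^q (z - c)^3] with [q = p - 4]
    and [K = p(p-1)(p-2)(p-3)/6], so [P_b - P_a] is [K] times the cubic
    [m0 z^3 - 3 m1 z^2 + 3 m2 z - m3], where [m_k] is the [k]-th moment of the
    weight [c^q] on [[a, b]].  If [r] is its real root and [mu = m1 / m0], the other
    two are [x1 +- i y1] with [2 x1 = 3 mu - r] and
    [y1^2 = 3 (m2 / m0 - mu^2) + 3/4 (mu - r)^2], positive by the strict
    Cauchy-Schwarz inequality.  If [n_k] is the [k]-th moment of [c - a], then
    [9 n1 n2 - n0 n3 = 2 n0^2 (x1 - a) ((x1 + r - 2 a)^2 + y1^2)],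
    so [a < x1] amounts to [n0 n3 < 9 n1 n2].  This holds because
    [n3 <= (b - a) n2] and [(b - a) n0 <= 3 n1], the latter by comparing [c^q]
    with [c^(-1/2)].
    Part (ii) is the mirror image, with [b - c] in place of [c - a] and the
    constant weight in place of [c^(-1/2)]. *)

(** * Derivatives of real powers and the expansion of [P] in powers of [z] *)

Lemma is_derive_Rpower (p c : R) : 0 < c ->
  is_derive (fun x => Rpower x p) c (p * Rpower c (p - 1)).
Proof.
  intros Hc. apply is_derive_Reals. now apply derivable_pt_lim_power.
Qed.

(** The half-line is open, so agreement there is agreement near [c]. Asking for no more lets the
    lemma be reapplied to derivatives it has itself computed. *)
Lemma Derive_scal_Rpower (f : R -> R) (k p c : R) :
  (forall x, 0 < x -> f x = k * Rpower x p) -> 0 < c ->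
  Derive f c = k * p * Rpower c (p - 1).
Proof.
  intros Hf Hc.
  rewrite (Derive_ext_loc f (fun x => k * Rpower x p)).
  - rewrite Derive_scal.
    assert (E := is_derive_unique _ _ _ (is_derive_Rpower p c Hc)).
    transitivity (k * (p * Rpower c (p - 1))); [now f_equal | ring].
  - exists (mkposreal c Hc). intros y Hy. apply Hf.
    apply Rabs_def2 in Hy. unfold minus, plus, opp in Hy. simpl in Hy. lra.
Qed.

Lemma Rpower_minus_1_mult (p c : R) : 0 < c -> Rpower c (p - 1) * c = Rpower c p.
Proof.
  intros Hc. rewrite <- (Rpower_1 c Hc) at 2. rewrite <- Rpower_plus.
  f_equal. ring.
Qed.

Lemma Derive_n_Rpower_3 (p c : R) : 0 < c ->
  let f := fun x => Rpower x p in
  Derive_n f 1 c = p * Rpower c (p - 1) /\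
  Derive_n f 2 c = p * (p - 1) * Rpower c (p - 1 - 1) /\
  Derive_n f 3 c = p * (p - 1) * (p - 1 - 1) * Rpower c (p - 1 - 1 - 1).
Proof.
  intros Hc f.
  assert (D1 : forall x, 0 < x -> Derive_n f 1 x = p * Rpower x (p - 1)).
  { intros x Hx.
    transitivity (1 * p * Rpower x (p - 1)); [|ring].
    apply (Derive_scal_Rpower f); [|exact Hx]. intros y _. unfold f. ring. }
  assert (D2 : forall x, 0 < x ->
    Derive_n f 2 x = p * (p - 1) * Rpower x (p - 1 - 1)).
  { intros x Hx. now apply Derive_scal_Rpower. }
  repeat split; auto.
  now apply (Derive_scal_Rpower (Derive_n f 2)).
Qed.

(** The coefficient of [z^j] carries every factor of [p (p-1) (p-2) (p-3)] except [p - j], the one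
    that differentiating [c^(p-j)] supplies. *)
Lemma P_expand (p c : R) (z : C) : 0 < c ->
  P p c z =
  (RtoC (p * (p - 1) * (p - 2) / 6 * Rpower c (p - 3)) * z ^ 3
   - RtoC (p * (p - 1) * (p - 3) / 2 * Rpower c (p - 2)) * z ^ 2
   + RtoC (p * (p - 2) * (p - 3) / 2 * Rpower c (p - 1)) * z
   - RtoC ((p - 1) * (p - 2) * (p - 3) / 6 * Rpower c p))%C.
Proof.
  intros Hc. unfold P, taylor_poly.
  destruct (Derive_n_Rpower_3 p c Hc) as [D1 [D2 D3]].
  rewrite !sum_Sn, sum_O, D1, D2, D3.
  change (Derive_n (fun x => Rpower x p) 0 c) with (Rpower c p).
  (* Every power becomes [Rpower c (p - 3)] times a power of [c], so that [field] sees a single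
     transcendental atom. *)
  rewrite <- (Rpower_minus_1_mult p c Hc), <- (Rpower_minus_1_mult (p - 1) c Hc),
    <- (Rpower_minus_1_mult (p - 2) c Hc).
  replace (p - 1 - 1 - 1) with (p - 3) by ring.
  replace (p - 1 - 1) with (p - 2) by ring.
  rewrite <- (Rpower_minus_1_mult (p - 2) c Hc).
  replace (p - 2 - 1) with (p - 3) by ring.
  destruct z as [x y]. unfold plus; simpl.
  apply injective_projections; simpl; field.
Qed.

(** * Positive integrals and the moments of the weight [c^q] *)

(** The exceptional point makes room for squares such as [(c - s)^2]; if it is interior, the
    integral is split there. *)
Lemma RInt_pos_except (f : R -> R) (a b s : R) : a < b ->
  (forall x, a <= x <= b -> continuous f x) ->
  (forall x, a < x < b -> x <> s -> 0 < f x) ->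
  0 < RInt f a b.
Proof.
  intros Hab Hcont Hpos.
  assert (Hsub : forall u v, a <= u -> u < v -> v <= b ->
    (forall x, u < x < v -> x <> s) -> 0 < RInt f u v).
  { intros u v Hu Huv Hv Hs. apply RInt_gt_0; auto.
    - intros x Hx. apply Hpos; [lra | now apply Hs].
    - intros x Hx. apply Hcont; lra. }
  destruct (Rle_lt_dec s a) as [Hsa|Hsa].
  { apply Hsub; try lra. intros x Hx; lra. }
  destruct (Rle_lt_dec b s) as [Hsb|Hsb].
  { apply Hsub; try lra. intros x Hx; lra. }
  assert (Hex : forall u v, a <= u -> u < v -> v <= b -> ex_RInt f u v).
  { intros u v Hu Huv Hv. apply (@ex_RInt_continuous R_CompleteNormedModule).
    intros x Hx. rewrite Rmin_left, Rmax_right in Hx by lra. apply Hcont; lra. }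
  rewrite <- (RInt_Chasles f a s b) by (apply Hex; lra).
  apply Rplus_lt_0_compat; apply Hsub; try lra; intros x Hx; lra.
Qed.

Lemma continuous_Rpower (q x : R) : 0 < x -> continuous (fun c => Rpower c q) x.
Proof.
  intros Hx. apply (ex_derive_continuous (fun c => Rpower c q)).
  eexists. now apply is_derive_Rpower.
Qed.

Lemma Rpower_gt_0 (c q : R) : 0 < Rpower c q.
Proof. apply exp_pos. Qed.

Definition cubic (u0 u1 u2 u3 c : R) : R := u0 + u1 * c + u2 * c ^ 2 + u3 * c ^ 3.

Lemma continuous_weight_cubic (q u0 u1 u2 u3 x : R) : 0 < x ->
  continuous (fun c => Rpower c q * cubic u0 u1 u2 u3 c) x.
Proof.
  intros Hx. apply (continuous_mult (fun c => Rpower c q)).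
  - now apply continuous_Rpower.
  - apply (ex_derive_continuous (cubic u0 u1 u2 u3)). unfold cubic. auto_derive. auto.
Qed.

Definition moment (q a b : R) (k : nat) : R :=
  RInt (fun c => Rpower c q * c ^ k) a b.

Lemma is_RInt_moment (q a b : R) (k : nat) : 0 < a -> a < b ->
  is_RInt (fun c => Rpower c q * c ^ k) a b (moment q a b k).
Proof.
  intros Ha Hab. apply (RInt_correct (V := R_CompleteNormedModule)).
  apply (@ex_RInt_continuous R_CompleteNormedModule).
  intros x Hx. rewrite Rmin_left in Hx by lra.
  apply (continuous_mult (fun c => Rpower c q)).
  - apply continuous_Rpower; lra.
  - apply (ex_derive_continuous (fun c => c ^ k)). auto_derive. auto.
Qed.

Lemma RInt_weight_cubic (q a b u0 u1 u2 u3 : R) : 0 < a -> a < b ->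
  RInt (fun c => Rpower c q * cubic u0 u1 u2 u3 c) a b =
  u0 * moment q a b 0 + u1 * moment q a b 1
  + u2 * moment q a b 2 + u3 * moment q a b 3.
Proof.
  intros Ha Hab. apply is_RInt_unique.
  assert (H : forall u k, is_RInt (fun c => u * (Rpower c q * c ^ k)) a b
                            (u * moment q a b k)).
  { intros u k. apply (is_RInt_scal (V := R_NormedModule)). now apply is_RInt_moment. }
  apply (is_RInt_ext (fun c => u0 * (Rpower c q * c ^ 0) + u1 * (Rpower c q * c ^ 1)
    + u2 * (Rpower c q * c ^ 2) + u3 * (Rpower c q * c ^ 3))).
  - intros x _. unfold cubic. simpl. ring.
  - do 3 (apply (is_RInt_plus (V := R_NormedModule)); [|apply H]). apply H.
Qed.

(** Source of the strict linear inequalities between moments below. A cubic without interior zero is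
    handled with [s = a], which lies outside the open interval. *)
Lemma moment_combination_pos (q a b s u0 u1 u2 u3 : R) : 0 < a -> a < b ->
  (forall c, a < c < b -> c <> s -> 0 < cubic u0 u1 u2 u3 c) ->
  0 < u0 * moment q a b 0 + u1 * moment q a b 1
      + u2 * moment q a b 2 + u3 * moment q a b 3.
Proof.
  intros Ha Hab H. rewrite <- RInt_weight_cubic by assumption.
  apply (RInt_pos_except _ _ _ s); auto.
  - intros x Hx. apply continuous_weight_cubic. lra.
  - intros x Hx Hs. apply Rmult_lt_0_compat; [apply Rpower_gt_0 | now apply H].
Qed.

(** Keeping [l] as a factor, rather than dividing by it in the primitive [c^l / l], covers [l = 0]
    as well. *)
Lemma moment_FTC (q a b k l : R) (i : nat) : 0 < a -> a < b ->
  l = q + INR i + 1 ->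
  k * l * moment q a b i = k * Rpower b l - k * Rpower a l.
Proof.
  intros Ha Hab Hl.
  transitivity (RInt (fun c => k * l * (Rpower c q * c ^ i)) a b).
  - symmetry. apply is_RInt_unique. apply (is_RInt_scal (V := R_NormedModule)).
    now apply is_RInt_moment.
  - apply is_RInt_unique.
    assert (E : forall c, 0 < c -> Rpower c q * c ^ i = Rpower c (l - 1)).
    { intros c Hc. rewrite <- Rpower_pow, <- Rpower_plus by exact Hc. f_equal. lra. }
    apply (is_RInt_derive (fun c => k * Rpower c l)); intros x;
      rewrite Rmin_left by lra; intros Hx.
    + rewrite E by lra. rewrite Rmult_assoc.
      apply (is_derive_scal (fun c => Rpower c l)).
      apply is_derive_Rpower. lra.
    + apply (continuous_mult (fun _ => k * l)); [apply continuous_const|].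
      apply (continuous_mult (fun c => Rpower c q)).
      * apply continuous_Rpower; lra.
      * apply (ex_derive_continuous (fun c => c ^ i)). auto_derive. auto.
Qed.

Lemma P_diff_moments (p a b : R) (z : C) : 0 < a -> a < b ->
  let K := p * (p - 1) * (p - 2) * (p - 3) / 6 in
  let m := moment (p - 4) a b in
  (P p b z - P p a z)%C =
  (RtoC K * (RtoC (m 0%nat) * z ^ 3 - RtoC (3 * m 1%nat) * z ^ 2
             + RtoC (3 * m 2%nat) * z - RtoC (m 3%nat)))%C.
Proof.
  intros Ha Hab K m.
  rewrite !P_expand by lra.
  assert (E0 := moment_FTC (p - 4) a b (p * (p - 1) * (p - 2) / 6) (p - 3) 0
                 Ha Hab ltac:(simpl; ring)).
  assert (E1 := moment_FTC (p - 4) a b (p * (p - 1) * (p - 3) / 2) (p - 2) 1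
                 Ha Hab ltac:(simpl; ring)).
  assert (E2 := moment_FTC (p - 4) a b (p * (p - 2) * (p - 3) / 2) (p - 1) 2
                 Ha Hab ltac:(simpl; ring)).
  assert (E3 := moment_FTC (p - 4) a b ((p - 1) * (p - 2) * (p - 3) / 6) p 3
                 Ha Hab ltac:(simpl; ring)).
  fold m in E0, E1, E2, E3.
  transitivity
    (RtoC (K * m 0%nat) * z ^ 3 - RtoC (K * (3 * m 1%nat)) * z ^ 2
     + RtoC (K * (3 * m 2%nat)) * z - RtoC (K * m 3%nat))%C.
  (* Each regrouping of [K] isolates the factor [p - 3], [p - 2], [p - 1] or [p] that serves as [l]
     in [moment_FTC]. *)
  - replace (K * m 0%nat) with
      (p * (p - 1) * (p - 2) / 6 * (p - 3) * m 0%nat) by (unfold K; field).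
    replace (K * (3 * m 1%nat)) with
      (p * (p - 1) * (p - 3) / 2 * (p - 2) * m 1%nat) by (unfold K; field).
    replace (K * (3 * m 2%nat)) with
      (p * (p - 2) * (p - 3) / 2 * (p - 1) * m 2%nat) by (unfold K; field).
    replace (K * m 3%nat) with
      ((p - 1) * (p - 2) * (p - 3) / 6 * p * m 3%nat) by (unfold K; field).
    rewrite E0, E1, E2, E3, !RtoC_minus. ring.
  - rewrite !(RtoC_mult K). ring.
Qed.

(** * Factorization of a real cubic *)

Lemma cubic_real_root (u0 u1 u2 u3 : R) : 0 < u3 ->
  exists r, cubic u0 u1 u2 u3 r = 0.
Proof.
  intros H3.
  (* With [S = |u0| + |u1| + |u2|], this choice gives [u3 M^3 = u3 M^2 + S M^2]. As [M >= 1], the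
     lower terms are at most [S M^2] in absolute value at [-M] and [M], so the leading term decides
     both signs. *)
  set (M := 1 + (Rabs u0 + Rabs u1 + Rabs u2) / u3).
  assert (A0 := Rabs_pos u0). assert (A1 := Rabs_pos u1). assert (A2 := Rabs_pos u2).
  assert (HM : 1 <= M).
  { unfold M. assert (0 <= (Rabs u0 + Rabs u1 + Rabs u2) / u3); [|lra].
    apply Rle_div_r; lra. }
  assert (Hu : u3 * M = u3 + (Rabs u0 + Rabs u1 + Rabs u2)) by (unfold M; field; lra).
  assert (H2 : M <= M ^ 2) by (simpl; nra).
  assert (B0 : Rabs u0 <= Rabs u0 * M ^ 2) by (simpl in *; nra).
  assert (B1 : Rabs (u1 * M) <= Rabs u1 * M ^ 2).
  { rewrite Rabs_mult, (Rabs_pos_eq M) by lra. now apply Rmult_le_compat_l. }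
  assert (B2 : Rabs (u2 * M ^ 2) = Rabs u2 * M ^ 2).
  { rewrite Rabs_mult, (Rabs_pos_eq (M ^ 2)) by lra. ring. }
  assert (B3 : u3 * M ^ 3 = u3 * M ^ 2 + (Rabs u0 + Rabs u1 + Rabs u2) * M ^ 2)
    by (simpl in *; nra).
  assert (B4 : 0 < u3 * M ^ 2) by (apply Rmult_lt_0_compat; lra).
  assert (C0 := Rabs_maj2 u0). assert (C0' := Rle_abs u0).
  assert (C1 := Rabs_maj2 (u1 * M)). assert (C1' := Rle_abs (u1 * M)).
  assert (C2 := Rabs_maj2 (u2 * M ^ 2)). assert (C2' := Rle_abs (u2 * M ^ 2)).
  destruct (IVT (cubic u0 u1 u2 u3) (- M) M) as [r [_ Hr]].
  - intros x. apply continuity_pt_filterlim.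
    apply (ex_derive_continuous (cubic u0 u1 u2 u3)). unfold cubic. auto_derive. auto.
  - lra.
  - unfold cubic. replace ((- M) ^ 2) with (M ^ 2) by ring.
    replace (u3 * (- M) ^ 3) with (- (u3 * M ^ 3)) by ring. lra.
  - unfold cubic. lra.
  - now exists r.
Qed.

(** These are Vieta's relations for [m0 (z - r) ((z - x)^2 + y^2)]: the first determines [x] and the
    second determines [d = y^2]. *)
Lemma cubic_factorization (m0 m1 m2 m3 : R) : 0 < m0 -> m1 ^ 2 < m0 * m2 ->
  exists r x y : R, y <> 0 /\ 3 * m1 = m0 * (r + 2 * x) /\
    3 * m2 = m0 * (x ^ 2 + y ^ 2 + 2 * x * r) /\ m3 = m0 * (r * (x ^ 2 + y ^ 2)).
Proof.
  intros H0 Hv.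
  destruct (cubic_real_root (- m3) (3 * m2) (- (3 * m1)) m0 H0) as [r Hr].
  set (x := (3 * (m1 / m0) - r) / 2).
  set (d := 3 * (m2 / m0) - 2 * x * r - x ^ 2).
  assert (Hd : 0 < d).
  { replace d with (3 * ((m0 * m2 - m1 ^ 2) / m0 ^ 2) + 3 / 4 * (m1 / m0 - r) ^ 2)
      by (unfold d, x; field; lra).
    assert (0 < (m0 * m2 - m1 ^ 2) / m0 ^ 2).
    { apply Rdiv_lt_0_compat; [lra | now apply pow_lt]. }
    assert (P2 := pow2_ge_0 (m1 / m0 - r)). lra. }
  exists r, x, (sqrt d). rewrite pow2_sqrt by lra.
  split; [apply Rgt_not_eq; now apply sqrt_lt_R0|].
  split; [unfold x; field; lra|].
  split; [unfold d; field; lra|].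
  (* The third relation is where [r] being a root enters. *)
  unfold cubic in Hr.
  replace m3 with (3 * m2 * r + - (3 * m1) * r ^ 2 + m0 * r ^ 3) by lra.
  unfold d, x. field. lra.
Qed.

(** * Inequalities between moments *)

Lemma moment_0_pos (q a b : R) : 0 < a -> a < b -> 0 < moment q a b 0.
Proof.
  intros Ha Hab.
  assert (H := moment_combination_pos q a b a 1 0 0 0 Ha Hab).
  enough (0 < 1 * moment q a b 0 + 0 * moment q a b 1
      + 0 * moment q a b 2 + 0 * moment q a b 3) by lra.
  apply H. intros; unfold cubic; lra.
Qed.

(** The variance is positive: [(c - s)^2] is integrated about the mean [s], its only zero. *)
Lemma moment_Cauchy_Schwarz (q a b : R) : 0 < a -> a < b ->
  moment q a b 1 ^ 2 < moment q a b 0 * moment q a b 2.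
Proof.
  intros Ha Hab. set (m := moment q a b).
  assert (H0 : 0 < m 0%nat) by now apply moment_0_pos.
  set (s := m 1%nat / m 0%nat).
  assert (H : 0 < s ^ 2 * m 0%nat + (- 2 * s) * m 1%nat + 1 * m 2%nat + 0 * m 3%nat).
  { apply (moment_combination_pos q a b s); auto. intros c _ Hc. unfold cubic.
    replace (_ + _) with ((c - s) ^ 2) by ring.
    apply pow2_gt_0. lra. }
  assert (E : m 1%nat = s * m 0%nat) by (unfold s; field; lra).
  rewrite E in *. nra.
Qed.

(* [(c^(q' - q) - s^(q' - q)) (c - s)] is nonnegative because [c^(q' - q)] is
   nondecreasing; integrate it against [c^q]. *)
Lemma moment_compare (q q' a b s : R) : 0 < a -> a < b -> 0 < s -> q <= q' ->
  Rpower s (q' - q) * (moment q a b 1 - s * moment q a b 0)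
  <= moment q' a b 1 - s * moment q' a b 0.
Proof.
  intros Ha Hab Hs Hq. set (k := Rpower s (q' - q)).
  assert (Hex : forall r u0 u1,
    ex_RInt (fun c => Rpower c r * cubic u0 u1 0 0 c) a b).
  { intros r u0 u1. apply (@ex_RInt_continuous R_CompleteNormedModule).
    intros x Hx. rewrite Rmin_left in Hx by lra.
    apply continuous_weight_cubic. lra. }
  assert (H : RInt (fun c => Rpower c q * cubic (- (k * s)) k 0 0 c) a b
              <= RInt (fun c => Rpower c q' * cubic (- s) 1 0 0 c) a b).
  { apply RInt_le; [lra | apply Hex | apply Hex |].
    intros c Hc. unfold cubic.
    replace q' with (q + (q' - q)) by ring. rewrite Rpower_plus, Rmult_assoc.
    apply Rmult_le_compat_l; [apply Rlt_le, Rpower_gt_0|].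
    destruct (Rle_lt_dec s c) as [Hsc|Hsc].
    - assert (k <= Rpower c (q' - q)) by (apply Rle_Rpower_l; lra). nra.
    - assert (Rpower c (q' - q) <= k) by (apply Rle_Rpower_l; lra). nra. }
  rewrite !RInt_weight_cubic in H by assumption. lra.
Qed.

(** On [[0, b]] with [q > -1] the mean is [(q+1)/(q+2) b], which is [b/3] exactly at [q = -1/2]. For
    [a > 0] that weight leaves the explicit gap [2/3 A (B - A)^2], with [A] and [B] the square roots
    of the endpoints, and [moment_compare] carries its sign over to larger [q]. *)
Lemma moment_mean_ge (q a b : R) : 0 < a -> a < b -> - / 2 <= q ->
  (2 * a + b) / 3 * moment q a b 0 <= moment q a b 1.
Proof.
  intros Ha Hab Hq.
  assert (H := moment_compare (- / 2) q a b ((2 * a + b) / 3) Ha Hab ltac:(lra) Hq).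
  assert (E0 := moment_FTC (- / 2) a b 1 (/ 2) 0 Ha Hab ltac:(simpl; field)).
  assert (E1 := moment_FTC (- / 2) a b 1 (1 + / 2) 1 Ha Hab ltac:(simpl; field)).
  rewrite !Rpower_plus, !Rpower_1, !Rpower_sqrt in E1 by lra.
  rewrite !Rpower_sqrt in E0 by lra.
  assert (HA := sqrt_sqrt a ltac:(lra)). assert (HB := sqrt_sqrt b ltac:(lra)).
  assert (HA0 := sqrt_lt_R0 a Ha). assert (HAB := sqrt_lt_1 a b ltac:(lra) ltac:(lra) Hab).
  set (A := sqrt a) in *. set (B := sqrt b) in *.
  assert (G : moment (- / 2) a b 1 - (2 * a + b) / 3 * moment (- / 2) a b 0
              = 2 / 3 * (A * (B - A) ^ 2)).
  { replace (moment (- / 2) a b 1) with (2 / 3 * (b * B - a * A)) by lra.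
    replace (moment (- / 2) a b 0) with (2 * (B - A)) by lra.
    rewrite <- HA, <- HB. field. }
  rewrite G in H.
  assert (0 <= Rpower ((2 * a + b) / 3) (q - - / 2) * (2 / 3 * (A * (B - A) ^ 2))).
  { apply Rmult_le_pos; [apply Rlt_le, Rpower_gt_0|].
    assert (0 <= A * (B - A) ^ 2); [|lra].
    apply Rmult_le_pos; [lra | apply pow2_ge_0]. }
  lra.
Qed.

(** The constant weight has mean [(a + b)/2], below [(a + 2b)/3]; [moment_compare] carries this down
    to smaller [q], after cancelling its positive factor. *)
Lemma moment_mean_le (q a b : R) : 0 < a -> a < b -> q <= 0 ->
  moment q a b 1 <= (a + 2 * b) / 3 * moment q a b 0.
Proof.
  intros Ha Hab Hq.
  assert (H := moment_compare q 0 a b ((a + 2 * b) / 3) Ha Hab ltac:(lra) Hq).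
  assert (E0 := moment_FTC 0 a b 1 1 0 Ha Hab ltac:(simpl; ring)).
  assert (E1 := moment_FTC 0 a b 1 (1 + 1) 1 Ha Hab ltac:(simpl; ring)).
  rewrite !Rpower_plus, !Rpower_1 in E1 by lra.
  rewrite !Rpower_1 in E0 by lra.
  assert (G : moment 0 a b 1 - (a + 2 * b) / 3 * moment 0 a b 0 = - (b - a) ^ 2 / 6).
  { replace (moment 0 a b 1) with ((b * b - a * a) / 2) by lra.
    replace (moment 0 a b 0) with (b - a) by lra. field. }
  assert (K := Rpower_gt_0 ((a + 2 * b) / 3) (0 - q)).
  assert (S := pow2_ge_0 (b - a)).
  apply Rnot_lt_le. intros Hlt.
  assert (L := Rmult_lt_0_compat _ _ K (proj2 (Rlt_0_minus _ _) Hlt)).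
  lra.
Qed.

(** * Location of the nonreal roots *)

(** The brackets are the moments of [c - t]. A free centre [t] serves both parts, with [t = a] and
    [t = b]; the factor [k] is positive because [y <> 0]. *)
Lemma nonreal_root_pair_P_diff (p a b : R) : 0 < a -> a < b ->
  let m := moment (p - 4) a b in
  exists x y : R,
    nonreal_root_pair (fun z : C => (P p b z - P p a z)%C) x y /\
    forall t : R, exists k : R, 0 < k /\
      9 * (m 1%nat - t * m 0%nat) * (m 2%nat - 2 * t * m 1%nat + t ^ 2 * m 0%nat)
      - m 0%nat * (m 3%nat - 3 * t * m 2%nat + 3 * t ^ 2 * m 1%nat - t ^ 3 * m 0%nat)
      = k * (x - t).
Proof.
  intros Ha Hab m.
  assert (H0 : 0 < m 0%nat) by now apply moment_0_pos.
  destruct (cubic_factorization (m 0%nat) (m 1%nat) (m 2%nat) (m 3%nat) H0)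
    as [r [x [y [Hy [E1 [E2 E3]]]]]]; [now apply moment_Cauchy_Schwarz|].
  exists x, y. split.
  - split; [exact Hy|].
    split; rewrite P_diff_moments by assumption; fold m; rewrite E1, E2, E3;
      apply injective_projections; simpl; ring.
  - intros t. exists (2 * m 0%nat ^ 2 * ((x + r - 2 * t) ^ 2 + y ^ 2)). split.
    + assert (A := pow2_ge_0 (x + r - 2 * t)). assert (B := pow2_gt_0 y Hy).
      apply Rmult_lt_0_compat; [|lra].
      apply Rmult_lt_0_compat; [lra | now apply pow_lt].
    + replace (m 1%nat) with (m 0%nat * (r + 2 * x) / 3) by lra.
      replace (m 2%nat) with (m 0%nat * (x ^ 2 + y ^ 2 + 2 * x * r) / 3) by lra.
      rewrite E3. field.
Qed.

(** The chain is [n0 n3 < l n0 n2 <= 3 n1 n2 <= 9 n1 n2], the last step because [l n0 n2 > 0] makes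
    [n1 n2] positive. *)
Lemma lt_9_mult (l n0 n1 n2 n3 : R) : 0 < l -> 0 < n0 -> 0 < n2 ->
  n3 < l * n2 -> l * n0 <= 3 * n1 -> n0 * n3 < 9 * n1 * n2.
Proof.
  intros Hl H0 H2 H3 H1.
  assert (A := Rmult_lt_compat_l n0 _ _ H0 H3).
  assert (B := Rmult_le_compat_r n2 _ _ (Rlt_le _ _ H2) H1).
  assert (C := Rmult_lt_0_compat _ _ (Rmult_lt_0_compat _ _ Hl H0) H2).
  lra.
Qed.

Lemma shifted_moments_gt (q a b : R) : 0 < a -> a < b -> - / 2 <= q ->
  let m := moment q a b in
  m 0%nat * (m 3%nat - 3 * a * m 2%nat + 3 * a ^ 2 * m 1%nat - a ^ 3 * m 0%nat)
  < 9 * (m 1%nat - a * m 0%nat) * (m 2%nat - 2 * a * m 1%nat + a ^ 2 * m 0%nat).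
Proof.
  intros Ha Hab Hq m.
  assert (H0 := moment_0_pos q a b Ha Hab).
  assert (H1 := moment_mean_ge q a b Ha Hab Hq).
  assert (H2 := moment_combination_pos q a b a (a ^ 2) (- 2 * a) 1 0 Ha Hab).
  (* The coefficients are those of [(c - a)^2 (b - c)], whose integral is [(b - a) n2 - n3] for the
     moments [n_k] of [c - a]. *)
  assert (H3 := moment_combination_pos q a b a
    (a ^ 2 * b) (- (a ^ 2 + 2 * a * b)) (b + 2 * a) (- 1) Ha Hab).
  fold m in H0, H1, H2, H3.
  apply (lt_9_mult (b - a)); try lra.
  - enough (0 < a ^ 2 * m 0%nat + - 2 * a * m 1%nat + 1 * m 2%nat + 0 * m 3%nat)
      by lra.
    apply H2. intros c Hc _. unfold cubic.
    replace (_ + _) with ((c - a) ^ 2) by ring. apply pow_lt. lra.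
  - enough (0 < a ^ 2 * b * m 0%nat + - (a ^ 2 + 2 * a * b) * m 1%nat
                + (b + 2 * a) * m 2%nat + - 1 * m 3%nat) by lra.
    apply H3. intros c Hc _. unfold cubic.
    replace (_ + _) with ((c - a) ^ 2 * (b - c)) by ring.
    apply Rmult_lt_0_compat; [apply pow_lt|]; lra.
Qed.

Lemma shifted_moments_lt (q a b : R) : 0 < a -> a < b -> q <= 0 ->
  let m := moment q a b in
  9 * (m 1%nat - b * m 0%nat) * (m 2%nat - 2 * b * m 1%nat + b ^ 2 * m 0%nat)
  < m 0%nat * (m 3%nat - 3 * b * m 2%nat + 3 * b ^ 2 * m 1%nat - b ^ 3 * m 0%nat).
Proof.
  intros Ha Hab Hq m.
  assert (H0 := moment_0_pos q a b Ha Hab).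
  assert (H1 := moment_mean_le q a b Ha Hab Hq).
  assert (H2 := moment_combination_pos q a b a (b ^ 2) (- 2 * b) 1 0 Ha Hab).
  assert (H3 := moment_combination_pos q a b a
    (- (a * b ^ 2)) (b ^ 2 + 2 * a * b) (- (a + 2 * b)) 1 Ha Hab).
  fold m in H0, H1, H2, H3.
  (* Passing from [c - b] to [b - c] changes the sign of the odd moments, which reverses the
     inequality. *)
  enough (m 0%nat * (b ^ 3 * m 0%nat - 3 * b ^ 2 * m 1%nat + 3 * b * m 2%nat - m 3%nat)
    < 9 * (b * m 0%nat - m 1%nat) * (m 2%nat - 2 * b * m 1%nat + b ^ 2 * m 0%nat))
    by lra.
  apply (lt_9_mult (b - a)); try lra.
  - enough (0 < b ^ 2 * m 0%nat + - 2 * b * m 1%nat + 1 * m 2%nat + 0 * m 3%nat)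
      by lra.
    apply H2. intros c Hc _. unfold cubic.
    replace (_ + _) with ((b - c) ^ 2) by ring. apply pow_lt. lra.
  - enough (0 < - (a * b ^ 2) * m 0%nat + (b ^ 2 + 2 * a * b) * m 1%nat
                + - (a + 2 * b) * m 2%nat + 1 * m 3%nat) by lra.
    apply H3. intros c Hc _. unfold cubic.
    replace (_ + _) with ((b - c) ^ 2 * (c - a)) by ring.
    apply Rmult_lt_0_compat; [apply pow_lt|]; lra.
Qed.

Theorem theorem2 (p : R) :
  (7 / 2 <= p ->
   forall a b : R, 0 < a -> a < b ->
   exists x1 y1 : R,
     nonreal_root_pair (fun z : C => (P p b z - P p a z)%C) x1 y1 /\ a < x1)
  /\
  (p < 2 -> p <> 0 -> p <> 1 ->
   forall a b : R, 0 < a -> a < b ->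
   exists x1 y1 : R,
     nonreal_root_pair (fun z : C => (P p b z - P p a z)%C) x1 y1 /\ x1 < b).
Proof.
  split.
  - intros Hp a b Ha Hab.
    destruct (nonreal_root_pair_P_diff p a b Ha Hab) as [x [y [Hroot Hsign]]].
    exists x, y. split; [exact Hroot|].
    destruct (Hsign a) as [k [Hk E]].
    (* The bound [p >= 7/2] is exactly [q = p - 4 >= -1/2]. *)
    assert (H := shifted_moments_gt (p - 4) a b Ha Hab ltac:(lra)).
    apply Rminus_lt_0, (Rmult_lt_reg_l k); simpl in *; lra.
  - intros Hp _ _ a b Ha Hab.
    destruct (nonreal_root_pair_P_diff p a b Ha Hab) as [x [y [Hroot Hsign]]].
    exists x, y. split; [exact Hroot|].
    destruct (Hsign b) as [k [Hk E]].
    assert (H := shifted_moments_lt (p - 4) a b Ha Hab ltac:(lra)).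
    apply Rminus_lt_0, (Rmult_lt_reg_l k); simpl in *; lra.
Qed.
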